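(* Consider OCS-max with parameters $0<L<U$, $\beta\in(0,L/2)$, and let $\omega=W\!\left(\frac{U/L-1-2\beta/L}{e^{1+2\beta/L}}\right)+1+\frac{2\beta}{L}$ ($W$ the Lambert $W$ function). Given $\epsilon\in[0,\omega-1]$, the algorithm RO-Advice-max described in the context is $(1+\epsilon)$-consistent and $\left(\frac{(\omega-1)(1+\epsilon)}{\epsilon+\frac{L-2\beta}{U}(\omega-1-\epsilon)}\right)$-robust for OCS-max.
   Context: OCS-max: known horizon $T$, rate constraints $d_t\in(0,1]$, constants $0<L<U$, switching cost coefficient $\beta\in(0,L/2)$; an instance is a sequence of concave price functions $g_t:[0,1]\to\mathbb{R}_{\ge0}$, $g_t(0)=0$, $L\le g_t'\le U$, revealed online; the player chooses irrevocably $x_t\in[0,d_t]$ with $\sum_tx_t=1$, and with $x_0=x_{T+1}=0$ earns $\sum_tg_t(x_t)-\beta\sum_{t=1}^{T+1}|x_t-x_{t-1}|$; OPT is the offline optimal profit. Advice: black-box advice $\hat x_1,\dots,\hat x_T$, always feasible ($\hat x_t\in[0,d_t]$, $\sum_t\hat x_t=1$); it is correct if playing $\hat x_t$ at each step (algorithm ADV) attains OPT. Consistency is the competitive ratio $\sup\mathrm{OPT}/\mathrm{ALG}$ over instances with correct advice; robustness is the competitive ratio for arbitrary feasible advice. RORO-max (robust subroutine): with $\Phi(w)=L+\beta+(\omega L-L-2\beta)e^{\omega w}$, $\Psi_t(x)=\int_{w^{(t-1)}}^{w^{(t-1)}+x}\Phi(u)du$ and $w^{(t)}$ its own cumulative sales,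 it computes $x_t^+\in\arg\max_{x\in[x_{t-1},\min(1-w^{(t-1)},d_t)]}g_t(x)-\beta(x-x_{t-1})-\Psi_t(x)$ and $x_t^-\in\arg\max_{x\in[0,\min(x_{t-1},d_t)]}g_t(x)-\beta(x_{t-1}-x)-\Psi_t(x)$ and plays whichever has the larger value of $g_t(x)-\beta|x-x_{t-1}|-\Psi_t(x)$; when remaining rate capacity would be insufficient, it sells maximally until the total equals 1. Denote its decisions $\tilde x_t$; it is $\omega$-competitive. RO-Advice-max: set $\lambda=\left(\frac{\omega}{1+\epsilon}-1\right)\frac{1}{\omega-1}\in[0,1]$ and play $x_t=\lambda\hat x_t+(1-\lambda)\tilde x_t$.
   Formalization: RORO-max is not ω-competitive on all instances (a forced final sale pays switching cost), so the claim fails for ε>0; it is stated for any class of instances on which RORO-max is ω-competitive, with consistency and robustness taken over that class. RORO-max's sales are capped at the unsold amount. *)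

(* Defs.v *)
(* MathComp / MathComp-Analysis, over an arbitrary realType. *)
From HB Require Import structures.
From mathcomp Require Export all_boot all_order all_algebra.
From mathcomp Require Export all_classical all_reals all_analysis.

Set Implicit Arguments.
Unset Strict Implicit.
Unset Printing Implicit Defensive.

Import Order.TTheory GRing.Theory Num.Theory.
Import numFieldNormedType.Exports.
Local Open Scope classical_set_scope.
Local Open Scope ring_scope.

(* Time steps are 1, ..., horizon; the values of [rate], [price] and of decision
   sequences at other indices are never used. *)
Record ocs_instance (R : realType) := OcsInstance {
  horizon : nat;
  rate : nat -> R;
  price : nat -> R -> R }.

(* Only the values of g on [0, 1] matter: differentiability is asked for in the
   interior, together with continuity up to the endpoints. *)
Definition price_function (R : realType) (L U : R) (g : R -> R) : Prop :=
  [/\ g 0 = 0,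
      forall x, 0 <= x <= 1 -> 0 <= g x,
      convex_function (`[0, 1]%classic : set R^o) (\- g),
      {within `[0, 1], continuous g} &
      forall x, 0 < x < 1 -> derivable g x 1 /\ L <= derive1 g x <= U].

(* The last clause says that the whole asset can be sold under the rate
   constraints; without it there is no feasible decision sequence. *)
Definition ocs_max_instance (R : realType) (L U : R) (I : ocs_instance R) :
    Prop :=
  [/\ forall t, (1 <= t <= horizon I)%N -> 0 < rate I t <= 1,
      forall t, (1 <= t <= horizon I)%N -> price_function L U (price I t) &
      1 <= \sum_(1 <= t < (horizon I).+1) rate I t].

(* The decision at time t, with the convention x_0 = x_{T+1} = 0. *)
Definition decision (R : realType) (I : ocs_instance R) (x : nat -> R)
    (t : nat) : R :=
  if (1 <= t <= horizon I)%N then x t else 0.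

Definition feasible (R : realType) (I : ocs_instance R) (x : nat -> R) : Prop :=
  (forall t, (1 <= t <= horizon I)%N -> 0 <= x t <= rate I t) /\
  \sum_(1 <= t < (horizon I).+1) x t = 1.

Definition profit (R : realType) (beta : R) (I : ocs_instance R)
    (x : nat -> R) : R :=
  \sum_(1 <= t < (horizon I).+1) price I t (x t)
  - beta * \sum_(1 <= t < (horizon I).+2)
             `|decision I x t - decision I x t.-1|.

Definition OPT (R : realType) (beta : R) (I : ocs_instance R) : R :=
  sup [set profit beta I x | x in feasible I].

(* OPT / ALG, where a nonpositive profit counts as an infinite ratio. *)
Definition profit_ratio (R : realType) (beta : R) (I : ocs_instance R)
    (x : nat -> R) : \bar R :=
  if 0 < profit beta I x then (OPT beta I / profit beta I x)%:E else +oo%E.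

(* An algorithm is represented by its set of executions (I, x), where x is a
   sequence of decisions that it may play on the instance I. *)
Definition competitive_ratio (R : realType) (beta : R)
    (S : set (ocs_instance R * (nat -> R))) : \bar R :=
  ereal_sup [set profit_ratio beta p.1 p.2 | p in S].

(* Principal branch of the Lambert W function, on z >= -1/e. *)
Definition lambertW (R : realType) (z : R) : R :=
  xget 0 [set w : R | -1 <= w /\ w * expR w = z].

Definition omega (R : realType) (L U beta : R) : R :=
  lambertW ((U / L - 1 - 2 * beta / L) / expR (1 + 2 * beta / L))
  + 1 + 2 * beta / L.

Definition argmax (R : realType) (A : set R) (f : R -> R) : set R :=
  [set x | A x /\ forall y, A y -> f y <= f x].

(* The cumulative sales w^(t). *)
Definition sold (R : realType) (x : nat -> R) (t : nat) : R :=
  \sum_(1 <= s < t.+1) x s.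

Definition Phi (R : realType) (L U beta : R) (w : R) : R :=
  L + beta + (omega L U beta * L - L - 2 * beta) * expR (omega L U beta * w).

Definition Psi (R : realType) (L U beta : R) (w x : R) : R :=
  \int[@lebesgue_measure R]_(u in `[w, w + x]) Phi L U beta u.

Definition roro_value (R : realType) (L U beta : R) (g : R -> R)
    (xprev w x : R) : R :=
  g x - beta * `|x - xprev| - Psi L U beta w x.

(* The interval of x^+ is empty when x_{t-1} > min (1 - w^(t-1)) d_t; only x^-
   is available then. *)
Definition roro_plus (R : realType) (L U beta : R) (g : R -> R)
    (d xprev w : R) : set R :=
  argmax `[xprev, Num.min (1 - w) d]
         (fun x => g x - beta * (x - xprev) - Psi L U beta w x).

Definition roro_minus (R : realType) (L U beta : R) (g : R -> R)
    (d xprev w : R) : set R :=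
  argmax `[0, Num.min xprev d]
         (fun x => g x - beta * (xprev - x) - Psi L U beta w x).

Definition roro_best (R : realType) (L U beta : R) (g : R -> R)
    (d xprev w : R) : set R :=
  argmax (roro_plus L U beta g d xprev w `|` roro_minus L U beta g d xprev w)
         (roro_value L U beta g xprev w).

(* [a] is what would be sold at time t outside compulsory trade: the better of
   x^+ and x^-, cut at the amount left to sell (the interval of x^- alone does
   not prevent the total from exceeding 1). *)
Definition roro_proposal (R : realType) (L U beta : R) (I : ocs_instance R)
    (x : nat -> R) (t : nat) (a : R) : Prop :=
  exists2 c, roro_best L U beta (price I t) (rate I t)
               (decision I x t.-1) (sold x t.-1) c
           & a = Num.min c (1 - sold x t.-1).

(* Selling [a] at time t leaves enough capacity to sell the rest later. *)
Definition enough_capacity (R : realType) (I : ocs_instance R)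
    (x : nat -> R) (t : nat) (a : R) : Prop :=
  1 - (sold x t.-1 + a) <= \sum_(t.+1 <= s < (horizon I).+1) rate I s.

(* Executions of RORO-max; there may be several since maximizers need not be
   unique. Compulsory trade starts at the first time k at which the proposal
   would leave too little capacity (k = T + 1 if there is no such time), and
   lasts until the end. *)
Definition roro_max (R : realType) (L U beta : R) (I : ocs_instance R)
    (x : nat -> R) : Prop :=
  exists k : nat,
  [/\ (1 <= k <= (horizon I).+1)%N,
      forall t, (1 <= t < k)%N ->
        roro_proposal L U beta I x t (x t) /\ enough_capacity I x t (x t),
      (k <= horizon I)%N ->
        exists2 a, roro_proposal L U beta I x k a & ~ enough_capacity I x k a &
      forall t, (k <= t <= horizon I)%N ->
        x t = Num.min (rate I t) (1 - sold x t.-1)].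

Definition roro_max_runs (R : realType) (L U beta : R)
    (C : set (ocs_instance R)) : set (ocs_instance R * (nat -> R)) :=
  [set p | C p.1 /\ roro_max L U beta p.1 p.2].

Definition advice_weight (R : realType) (L U beta eps : R) : R :=
  (omega L U beta / (1 + eps) - 1) * (omega L U beta - 1)^-1.

Definition ro_advice_max (R : realType) (L U beta eps : R)
    (xhat xtilde : nat -> R) (t : nat) : R :=
  advice_weight L U beta eps * xhat t
  + (1 - advice_weight L U beta eps) * xtilde t.

Definition correct_advice (R : realType) (beta : R) (I : ocs_instance R)
    (xhat : nat -> R) : Prop :=
  feasible I xhat /\ profit beta I xhat = OPT beta I.

(* Executions of RO-Advice-max on instances of C, with advice satisfying A. *)
Definition ro_advice_max_runs (R : realType) (L U beta eps : R)
    (C : set (ocs_instance R)) (A : ocs_instance R -> (nat -> R) -> Prop) :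
    set (ocs_instance R * (nat -> R)) :=
  [set p | C p.1 /\ exists xhat xtilde,
     [/\ A p.1 xhat, roro_max L U beta p.1 xtilde &
         p.2 = ro_advice_max L U beta eps xhat xtilde]].

Definition consistency (R : realType) (L U beta eps : R)
    (C : set (ocs_instance R)) : \bar R :=
  competitive_ratio beta
    (ro_advice_max_runs L U beta eps C (@correct_advice R beta)).

Definition robustness (R : realType) (L U beta eps : R)
    (C : set (ocs_instance R)) : \bar R :=
  competitive_ratio beta (ro_advice_max_runs L U beta eps C (@feasible R)).

(* Main.v *)
(* Concavity of the prices and convexity of the switching cost make the profit
   concave, so that mixing guarantees
     ALG >= lambda ADV + (1 - lambda) RORO,   with RORO >= OPT / omega.
   Correct advice has ADV = OPT, and lambda + (1 - lambda) / omega = 1 / (1 + eps).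
   Any feasible decisions earn at least L - 2 beta (the total variation is at most
   2) and at most U, hence ADV >= (L - 2 beta) / U * OPT for arbitrary advice. *)
From mathcomp Require Import ring lra.
Require Import Defs.
Import Order.TTheory GRing.Theory Num.Theory.
Import numFieldNormedType.Exports.
Local Open Scope classical_set_scope.
Local Open Scope ring_scope.

Set Implicit Arguments.
Unset Strict Implicit.

(** A nonpositive profit has ratio [+oo], so a finite bound on the supremum forces positive profits.
    This removes extended reals and divisions from all later arguments. *)
Lemma competitive_ratio_leP (R : realType) (beta c : R)
    (S : set (ocs_instance R * (nat -> R))) :
  (competitive_ratio beta S <= c%:E)%E <->
  forall I x, S (I, x) -> 0 < profit beta I x /\ OPT beta I <= c * profit beta I x.
Proof.
rewrite /competitive_ratio; split.
- move=> Sc I x SIx.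
  have: (profit_ratio beta I x <= c%:E)%E.
    by apply: le_trans Sc; apply: ereal_sup_ubound; exists (I, x).
  rewrite /profit_ratio; case: ifPn => [p0|_]; last by rewrite leye_eq.
  by rewrite lee_fin ler_pdivrMr.
- move=> Sc; apply: ge_ereal_sup => _ [[I x] /Sc[p0 pc] <-] /=.
  by rewrite /profit_ratio p0 lee_fin ler_pdivrMr.
Qed.

Lemma price_function_concave (R : realType) (L U : R) (g : R -> R) (l x y : R) :
  price_function L U g -> 0 <= l <= 1 -> 0 <= x <= 1 -> 0 <= y <= 1 ->
  l * g x + (1 - l) * g y <= g (l * x + (1 - l) * y).
Proof.
move=> [_ _ cg _ _] /andP[l0 l1] x01 y01.
have := cg (Itv01 l0 l1) x y.
rewrite !inE /= !in_itv /= => /(_ x01 y01).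
by rewrite !convRE /= /unstable.onem; lra.
Qed.

(** Mean value theorem on [[0, x]], whose interior lies in []0, 1[], where the slope bounds hold;
    the case [x = 0] is [g 0 = 0]. *)
Lemma price_function_bounds (R : realType) (L U : R) (g : R -> R) (x : R) :
  price_function L U g -> 0 <= x <= 1 -> L * x <= g x <= U * x.
Proof.
move=> [g0 _ _ cg dg] /andP[]; rewrite le_eqVlt => /predU1P[<- _|x0 x1].
  by rewrite g0 !mulr0 lexx.
have sub y : y \in `]0, x[ -> 0 < y < 1.
  by rewrite in_itv /= => /andP[-> yx] /=; exact: lt_le_trans x1.
have dx y : y \in `]0, x[ -> is_derive y 1 g (derive1 g y).
  by move=> /sub/dg[+ _]; rewrite derive1E => /derivableP.
have cx : {within `[0, x], continuous g}.
  have sub01 : `[0, x] `<=` `[0, 1].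
    by move=> y /=; rewrite !in_itv /= => /andP[-> yx]; exact: le_trans x1.
  exact: (continuous_subspaceW sub01 cg).
have [c /sub/dg[_ /andP[Lc cU]]] := MVT x0 dx cx.
rewrite g0 !subr0 => ->.
by rewrite !ler_pM2r// Lc cU.
Qed.

(** Decisions are only asked to lie in [[0, 1]], which is the form in which [roro_max_01] supplies
    them for RORO-max. *)
Lemma profit_concave (R : realType) (L U beta l : R) (I : ocs_instance R)
    (x y : nat -> R) :
  0 <= beta -> ocs_max_instance L U I -> 0 <= l <= 1 ->
  (forall t, (1 <= t <= horizon I)%N -> 0 <= x t <= 1) ->
  (forall t, (1 <= t <= horizon I)%N -> 0 <= y t <= 1) ->
  l * profit beta I x + (1 - l) * profit beta I y
  <= profit beta I (fun t => l * x t + (1 - l) * y t).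
Proof.
move=> beta0 [_ pI _] l01 x01 y01; set z := fun t => _.
have dz t : decision I z t = l * decision I x t + (1 - l) * decision I y t.
  by rewrite /decision; case: ifP => //; rewrite !mulr0 addr0.
have gz : l * (\sum_(1 <= t < (horizon I).+1) price I t (x t))
          + (1 - l) * (\sum_(1 <= t < (horizon I).+1) price I t (y t))
          <= \sum_(1 <= t < (horizon I).+1) price I t (z t).
  rewrite !mulr_sumr -big_split /=; apply: ler_sum_nat => t tI.
  exact: price_function_concave (pI t tI) l01 (x01 t tI) (y01 t tI).
have sz : \sum_(1 <= t < (horizon I).+2) `|decision I z t - decision I z t.-1|
    <= l * (\sum_(1 <= t < (horizon I).+2)
              `|decision I x t - decision I x t.-1|)
       + (1 - l) * (\sum_(1 <= t < (horizon I).+2)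
              `|decision I y t - decision I y t.-1|).
  rewrite !mulr_sumr -big_split /=; apply: ler_sum_nat => t _.
  have [l0 l1] : 0 <= l /\ 0 <= 1 - l by lra.
  rewrite -{1}(ger0_norm l0) -{1}(ger0_norm l1) -!normrM.
  apply: le_trans (ler_normD _ _); rewrite !dz.
  by rewrite le_eqVlt; apply/orP; left; apply/eqP; congr `|_|; ring.
have := ler_wpM2l beta0 sz.
by rewrite /profit; lra.
Qed.

(** For nonnegative decisions [|a - b| <= a + b], and each [x t] occurs in exactly two consecutive
    differences. *)
Lemma switching_le (R : realType) (I : ocs_instance R) (x : nat -> R) :
  (forall t, (1 <= t <= horizon I)%N -> 0 <= x t) ->
  \sum_(1 <= t < (horizon I).+2) `|decision I x t - decision I x t.-1|
  <= 2 * \sum_(1 <= t < (horizon I).+1) x t.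
Proof.
move=> x0.
have d0 t : 0 <= decision I x t by rewrite /decision; case: ifP => // /x0.
have dx : \sum_(1 <= t < (horizon I).+1) decision I x t
          = \sum_(1 <= t < (horizon I).+1) x t.
  by apply: eq_big_nat => t tI; rewrite /decision ifT.
apply: (@le_trans _ _ (\sum_(1 <= t < (horizon I).+2)
                         (decision I x t + decision I x t.-1))).
  apply: ler_sum_nat => t _; apply: le_trans (ler_normB _ _) _.
  by rewrite !ger0_norm.
(* Both sums reduce to the range 1..T once the boundary decisions at T + 1 and at 0, which vanish,
   are split off. *)
rewrite big_split /= [X in X + _]big_nat_recr//= [X in _ + X]big_add1 /=.
rewrite [X in _ + X]big_ltn// dx.
have -> : decision I x (horizon I).+1 = 0 by rewrite /decision ltnn andbF.
by rewrite [decision I x 0]/decision /=; lra.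
Qed.

Lemma feasible_01 (R : realType) (L U : R) (I : ocs_instance R) (x : nat -> R) :
  ocs_max_instance L U I -> feasible I x ->
  forall t, (1 <= t <= horizon I)%N -> 0 <= x t <= 1.
Proof.
move=> [rI _ _] [xI _] t tI; have /andP[-> xr] := xI t tI.
by have /andP[_ r1] := rI t tI; exact: le_trans r1.
Qed.

Lemma feasible_profit_bounds (R : realType) (L U beta : R) (I : ocs_instance R)
    (x : nat -> R) :
  0 <= beta -> ocs_max_instance L U I -> feasible I x ->
  L - 2 * beta <= profit beta I x <= U.
Proof.
move=> beta0 oI fx; have x01 := feasible_01 oI fx.
case: oI fx => _ pI _ [_ x1].
have sum_bounds : L <= \sum_(1 <= t < (horizon I).+1) price I t (x t) <= U.
  rewrite -(mulr1 L) -(mulr1 U) -x1 !mulr_sumr.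
  by apply/andP; split; apply: ler_sum_nat => t tI;
    have /andP[] := price_function_bounds (pI t tI) (x01 t tI).
have sw0 : 0 <= \sum_(1 <= t < (horizon I).+2)
                 `|decision I x t - decision I x t.-1|.
  exact: sumr_ge0.
have sw2 : \sum_(1 <= t < (horizon I).+2)
                 `|decision I x t - decision I x t.-1| <= 2.
  apply: le_trans (switching_le _) _; last by rewrite x1 mulr1.
  by move=> t /x01/andP[].
have := ler_wpM2l beta0 sw2.
have := mulr_ge0 beta0 sw0.
by rewrite /profit; lra.
Qed.

Lemma OPT_le (R : realType) (L U beta : R) (I : ocs_instance R)
    (x : nat -> R) :
  0 <= beta -> ocs_max_instance L U I -> feasible I x -> OPT beta I <= U.
Proof.
move=> beta0 oI fx; apply: ge_sup; first by exists (profit beta I x), x.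
by move=> _ [y fy <-]; have /andP[] := feasible_profit_bounds beta0 oI fy.
Qed.

Lemma roro_max_01 (R : realType) (L U beta : R) (I : ocs_instance R)
    (x : nat -> R) :
  ocs_max_instance L U I -> roro_max L U beta I x ->
  forall t, (1 <= t <= horizon I)%N -> 0 <= x t <= 1.
Proof.
move=> [rI _ _] [k [_ xlt _ xge]].
(* The induction carries the bound on cumulative sales, which keeps the cut at the remaining amount
   nonnegative. *)
suff H t : (t <= horizon I)%N ->
    sold x t <= 1 /\ forall s, (1 <= s <= t)%N -> 0 <= x s <= 1.
  by move=> t /andP[t1 tT]; apply: (H t tT).2; rewrite t1 leqnn.
elim: t => [_|t IHt tT].
  split; first by rewrite /sold big_geq.
  by move=> s /andP[]; case: s.
have {IHt}[sold1 x01] := IHt (ltnW tT).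
have soldS : sold x t.+1 = sold x t + x t.+1 by rewrite /sold big_nat_recr.
(* The interval of x^+ starts at the previous decision, so the sign of that decision gives the sign
   of x^+. *)
have d0 : 0 <= decision I x t.
  rewrite /decision; case: ifP => // /andP[t1 _].
  by have /andP[] : 0 <= x t <= 1 by apply: x01; rewrite t1 leqnn.
have [r0 r1] := andP (rI t.+1 tT).
(* Both phases have this shape: [c] is the chosen maximizer before compulsory trade and the rate
   during it. *)
have [c /andP[c0 c1] xt] : exists2 c, 0 <= c <= 1
    & x t.+1 = Num.min c (1 - sold x t).
  have [tk|kt] := ltnP t.+1 k.
    have [[c [cpm _] ->] _] := xlt t.+1 tk; exists c => //.
    case: cpm => -[] /=; rewrite in_itv /= le_min => + _; lra.
  by exists (rate I t.+1); [rewrite ltW|apply: xge; rewrite kt].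
have xt01 : 0 <= x t.+1 <= 1.
  by rewrite xt le_min c0 subr_ge0 sold1 ge_min c1.
split.
  by rewrite soldS xt -lerBrDl ge_min lexx orbT.
move=> s /andP[s1]; rewrite leq_eqVlt => /predU1P[->//|st].
by apply: x01; rewrite s1.
Qed.

(* If W(z) in the definition of omega were -2 beta / L, then U / L - 1 - 2 beta / L
   would be -(2 beta / L) e, which is less than -2 beta / L. If the equation for W
   had no solution, lambertW would be 0, which is also different. *)
Lemma omega_neq1 (R : realType) (L U beta : R) :
  0 < L -> L < U -> 0 < beta -> omega L U beta != 1.
Proof.
move=> L0 LU beta0; rewrite /omega /lambertW.
set b := 2 * beta / L; have b0 : 0 < b by rewrite divr_gt0 ?mulr_gt0.
have UL : 1 < U / L by rewrite ltr_pdivlMr ?mul1r.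
case: xgetP => [w _ [_ wE]|_]; last by apply/eqP; lra.
apply/eqP => w1; have {w1}wb : w = - b by lra.
move: wE; rewrite wb => /(congr1 (fun v => v * expR (1 + b))).
rewrite divfK ?gt_eqF ?expR_gt0// -mulrA -expRD addrCA addNr addr0 => e.
have e1 : 1 <= expR (1 : R) by have := expR_ge1Dx (1 : R); lra.
by have := ler_wpM2l (ltW b0) e1; lra.
Qed.

(** Concavity of the profit multiplied by (ω - 1)(1 + eps), a common denominator of the weights: λ
    has numerator ω - 1 - eps, and 1 - λ has numerator eps * ω. *)
Lemma ro_advice_profit (R : realType) (L U beta eps : R) (I : ocs_instance R)
    (xhat xtilde : nat -> R) :
  0 <= beta -> 1 < omega L U beta -> 0 <= eps <= omega L U beta - 1 ->
  ocs_max_instance L U I -> feasible I xhat -> roro_max L U beta I xtilde ->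
  ((omega L U beta - 1 - eps) * profit beta I xhat
   + eps * (omega L U beta * profit beta I xtilde))
  <= (omega L U beta - 1) * (1 + eps)
     * profit beta I (ro_advice_max L U beta eps xhat xtilde).
Proof.
move=> beta0; set w := omega L U beta => w1 /andP[e0 ew] oI fx rx.
have e1 : 0 < 1 + eps by lra.
have w0 : 0 < w - 1 by lra.
have lE : advice_weight L U beta eps = (w - 1 - eps) / ((w - 1) * (1 + eps)).
  by rewrite /advice_weight -/w; field; rewrite !gt_eqF.
have l01 : 0 <= advice_weight L U beta eps <= 1.
  rewrite lE divr_ge0 ?mulr_ge0 ?ler_pdivrMr ?mulr_gt0//=; try lra.
  by have := mulr_ge0 (ltW w0) e0; lra.
have := profit_concave beta0 oI l01 (feasible_01 oI fx) (roro_max_01 oI rx).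
rewrite -(ler_pM2l (mulr_gt0 w0 e1)); apply: le_trans.
rewrite le_eqVlt; apply/orP; left; apply/eqP.
by rewrite lE; field; rewrite !gt_eqF.
Qed.

Unset Implicit Arguments.
Set Strict Implicit.

Theorem theorem9 (R : realType) (L U beta eps : R)
    (hL : 0 < L) (hLU : L < U) (hbeta : 0 < beta < L / 2)
    (heps : 0 <= eps <= omega L U beta - 1)
    (C : set (ocs_instance R))
    (hC : forall I, C I -> ocs_max_instance L U I)
    (hroro : (competitive_ratio beta (roro_max_runs L U beta C)
              <= (omega L U beta)%:E)%E) :
  (consistency L U beta eps C <= (1 + eps)%:E)%E /\
  (robustness L U beta eps C
   <= ((omega L U beta - 1) * (1 + eps)
       / (eps + (L - 2 * beta) / U * (omega L U beta - 1 - eps)))%:E)%E.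
Proof.
have [beta_gt0 betaL] := andP hbeta; have beta0 := ltW beta_gt0.
have [eps0 epsw] := andP heps.
(* The range of [eps] already gives ω >= 1; equality has to be excluded because λ divides by ω -
   1. *)
have w1 : 1 < omega L U beta.
  by rewrite lt_neqAle eq_sym omega_neq1//=; lra.
have Lb : 0 < L - 2 * beta by lra.
have U0 : 0 < U by exact: lt_trans hLU.
have {}hroro I x : C I -> roro_max L U beta I x ->
    0 < profit beta I x /\ OPT beta I <= omega L U beta * profit beta I x.
  by move=> CI rx; apply: (competitive_ratio_leP _ _ _).1 hroro _ _ _.
set w := omega L U beta in heps epsw w1 hroro *.
have w0 : 0 < w - 1 by lra.
have we0 : 0 < (w - 1) * (1 + eps) by apply: mulr_gt0; lra.
have wle0 : 0 <= w - 1 - eps by lra.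
(* Both guarantees follow from this bound, where ω * RORO has been replaced by OPT. *)
have run I xhat xtilde : C I -> feasible I xhat -> roro_max L U beta I xtilde ->
    let ALG := profit beta I (ro_advice_max L U beta eps xhat xtilde) in
    0 < ALG /\ (w - 1 - eps) * profit beta I xhat + eps * OPT beta I
               <= (w - 1) * (1 + eps) * ALG.
  move=> CI fx rx ALG; have [p0 wp] := hroro _ _ CI rx.
  have /= := ro_advice_profit beta0 w1 heps (hC _ CI) fx rx.
  have /andP[hp _] := feasible_profit_bounds beta0 (hC _ CI) fx.
  have hp0 := lt_le_trans Lb hp; rewrite -/w -/ALG => ub; split.
    rewrite -(pmulr_rgt0 _ we0); apply: lt_le_trans ub.
    have wp0 : 0 < w * profit beta I xtilde by apply: mulr_gt0; lra.
    have := mulr_ge0 wle0 (ltW hp0); have := mulr_ge0 eps0 (ltW wp0).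
    (* For [eps = 0] RORO-max has weight 0 and positivity comes from the advice; otherwise it comes
       from RORO-max, as the advice may have weight 0. *)
    case: (ltgtP 0 eps) eps0 => // [e0|<-] _; last first.
      by rewrite subr0 mul0r addr0 => _ _; exact: mulr_gt0.
    by have := mulr_gt0 e0 wp0; lra.
  by apply: le_trans ub; rewrite lerD2l ler_wpM2l.
split; apply/competitive_ratio_leP => I x [/= CI [xhat [xtilde [+ rx ->]]]].
- move=> [fx xOPT]; have [ALG0] := run I _ _ CI fx rx.
  (* With ADV = OPT the left side of the bound collapses to (ω - 1) * OPT. *)
  split=> //; rewrite -(ler_pM2l w0); move: b; rewrite xOPT; lra.
- move=> fx; have [ALG0 b] := run I _ _ CI fx rx; split=> //.
  have OU := OPT_le beta0 (hC _ CI) fx.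
  have /andP[hp _] := feasible_profit_bounds beta0 (hC _ CI) fx.
  have lU0 : 0 < (L - 2 * beta) / U by exact: divr_gt0.
  have D0 : 0 < eps + (L - 2 * beta) / U * (w - 1 - eps).
    case: (ltgtP 0 eps) eps0 => // [e0|<-] _.
      by have := mulr_ge0 (ltW lU0) wle0; lra.
    by rewrite add0r subr0 mulr_gt0.
  (* The denominator is the coefficient of OPT once ADV is replaced by its lower bound (L - 2 beta)
     / U * OPT. *)
  rewrite mulrAC ler_pdivlMr//; apply: le_trans b.
  have : (L - 2 * beta) / U * OPT beta I <= profit beta I xhat.
    by apply: le_trans hp; rewrite -mulrA ger_pMr// mulrC ler_pdivrMr ?mul1r.
  by move=> /(ler_wpM2l wle0); lra.
Qed.
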